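(* The class of line graphs has the strong Erdős–Hajnal property: there exists $\delta>0$ such that every line graph $G$ with at least two vertices has a homogeneous pair $(P,Q)$ with $|P|,|Q|\geq \delta|V(G)|$.
   Context: A multigraph is a vertex set together with a multiset of edges, each edge an unordered pair of distinct vertices. The line graph $L(H)$ of a multigraph $H$ has vertex set $E(H)$ (the edges, counted with multiplicity), two of them adjacent iff they share an endpoint in $H$. A line graph is a graph isomorphic to $L(H)$ for some (multi)graph $H$. For disjoint vertex sets $P,Q$, $(P,Q)$ is a homogeneous pair if either all edges between $P$ and $Q$ are present or none are. *)

(* Defs.v *)
From HB Require Import structures.
From mathcomp Require Import all_boot all_order all_algebra.
From mathcomp Require Import reals.

Set Implicit Arguments.
Unset Strict Implicit.
Unset Printing Implicit Defensive.

Import Order.TTheory GRing.Theory Num.Theory.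

Record sgraph := SGraph {
  vertex :> finType;
  adj : rel vertex;
  adj_sym : symmetric adj;
  adj_irrefl : irreflexive adj
}.

(* The multiset of edges is a family of two-element vertex sets indexed by the
   finite type [edge]; parallel edges are distinct indices with equal [ends]. *)
Record multigraph := MultiGraph {
  mvertex : finType;
  edge : finType;
  ends : edge -> {set mvertex};
  card_ends : forall e, #|ends e| = 2
}.

Definition line_adj (H : multigraph) : rel (edge H) :=
  fun e f => (e != f) && [exists v, (v \in ends e) && (v \in ends f)].

Lemma line_adj_sym (H : multigraph) : symmetric (@line_adj H).
Proof.
move=> e f; rewrite /line_adj eq_sym; congr (_ && _).
by apply: eq_existsb => v; rewrite andbC.
Qed.

Lemma line_adj_irrefl (H : multigraph) : irreflexive (@line_adj H).
Proof. by move=> e; rewrite /line_adj eqxx. Qed.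

Definition line_graph_of (H : multigraph) : sgraph :=
  SGraph (@line_adj_sym H) (@line_adj_irrefl H).

Definition graph_iso (G G' : sgraph) : Prop :=
  exists2 f : G -> G', bijective f & forall x y, adj (f x) (f y) = adj x y.

Definition is_line_graph (G : sgraph) : Prop :=
  exists H : multigraph, graph_iso G (line_graph_of H).

Definition homogeneous_pair (G : sgraph) (P Q : {set G}) : Prop :=
  [disjoint P & Q] /\
  ((forall x y, x \in P -> y \in Q -> adj x y) \/
   (forall x y, x \in P -> y \in Q -> ~~ adj x y)).

Definition strong_Erdos_Hajnal (R : realType) (C : sgraph -> Prop) : Prop :=
  (exists delta : R, 0 < delta /\
    forall G : sgraph, C G -> (2 <= #|G|)%N ->
      exists P Q : {set G}, homogeneous_pair P Q /\
        delta * #|G|%:R <= #|P|%:R /\ delta * #|G|%:R <= #|Q|%:R)%R.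

(* Main.v *)
Require Import Defs.
From mathcomp Require Import all_boot all_order all_algebra.
From mathcomp Require Import reals.
From mathcomp Require Import zify.

(** If some vertex of the multigraph meets a positive proportion of the edges,
    these edges form a clique of the line graph, which is cut into two halves.
    Otherwise one looks for two disjoint vertex sets, each inducing a positive
    proportion of the edges.  Orient the edges arbitrarily and choose a vertex
    set [X] containing about half of the sources (possible as degrees are
    small).  If few edges cross [X], then [X] and its complement will do.
    If many edges cross [X], halve their ends in [X] and their ends outside [X]
    by [X1] and [Y1]: the numbers of crossing edges from [X1] to [Y1] and from
    its complement to the complement of [Y1] are close to each other, and so
    are the two mixed numbers; hence one of these two pairs of classes is
    large. *)

Set Implicit Arguments.
Unset Strict Implicit.
Unset Printing Implicit Defensive.

Import Order.TTheory GRing.Theory Num.Theory.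

(** A largest [X] whose fibres cover at most half of [F] works: one more vertex passes the half, yet
    gains at most [D] elements. *)
Lemma balanced_split (E V : finType) (F : {set E}) (s : E -> V) (D : nat) :
  (forall v, #|[set e in F | s e == v]| <= D) ->
  exists X : {set V}, let k := #|[set e in F | s e \in X]| in
    2 * k <= #|F| <= 2 * k + 2 * D.
Proof.
move=> leD; pose c (X : {set V}) := #|[set e in F | s e \in X]|.
have c0 : 2 * c set0 <= #|F|.
  by rewrite /c (_ : [set _ in _ | _] = set0) ?cards0 //;
     apply/setP=> e; rewrite !inE andbF.
have [X cX maxX] := @arg_maxnP _ set0 (fun X => 2 * c X <= #|F|)
  (fun X : {set V} => #|X|) c0.
exists X; rewrite /= cX /=; case: (eqVneq X setT) => [XT | XnT].
  have : #|[set e in F | s e \in X]| = #|F|.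
    by congr #|pred_of_set _|; apply/setP=> e; rewrite XT !inE andbT.
  lia.
have [v _ vX] : exists2 v, v \in [set: V] & v \notin X.
  by apply/subsetPn; apply: contra XnT; rewrite subTset.
have cvX : #|F| < 2 * c (v |: X).
  rewrite ltnNge; apply/negP=> /maxX; rewrite cardsU1 vX; lia.
have : c (v |: X) <= #|[set e in F | s e == v]| + c X.
  apply: leq_trans (leq_card_setU _ _); apply: subset_leq_card.
  by apply/subsetP=> e; rewrite !inE -andb_orr.
by have := leD v; rewrite -/(c X); lia.
Qed.

Lemma card_filter_predC (E : finType) (F : {set E}) (p : pred E) :
  #|F| = #|[set e in F | p e]| + #|[set e in F | ~~ p e]|.
Proof.
rewrite -(cardsID [set e | p e] F); congr (_ + _);
  by apply: eq_card => e; rewrite !inE // andbC.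
Qed.

Lemma crossed_split (E V : finType) (F : {set E}) (s t : E -> V) (D : nat) :
  (forall v, #|[set e in F | s e == v]| <= D) ->
  (forall v, #|[set e in F | t e == v]| <= D) ->
  exists X Y : {set V}, let k b c :=
    #|[set e in F | (s e \in X == b) && (t e \in Y == c)]| in
    exists b, #|F| <= 4 * k true b + 4 * D /\ #|F| <= 4 * k false (~~ b) + 4 * D.
Proof.
move=> /balanced_split[X /= bX] /balanced_split[Y /= bY]; exists X, Y.
pose k b c := #|[set e in F | (s e \in X == b) && (t e \in Y == c)]|.
suff : exists b, #|F| <= 4 * k true b + 4 * D /\
  #|F| <= 4 * k false (~~ b) + 4 * D by [].
have eF := card_filter_predC F (fun e => s e \in X).
have eX := card_filter_predC [set e in F | s e \in X] (fun e => t e \in Y).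
have eXc := card_filter_predC [set e in F | s e \notin X] (fun e => t e \in Y).
have eY := card_filter_predC [set e in F | t e \in Y] (fun e => s e \in X).
have E11 : #|[set e in [set e in F | s e \in X] | t e \in Y]| = k true true.
  by apply: eq_card => e; rewrite !inE !eqb_id andbA.
have E10 : #|[set e in [set e in F | s e \in X] | t e \notin Y]| = k true false.
  by apply: eq_card => e; rewrite !inE eqb_id eqbF_neg andbA.
have E01 : #|[set e in [set e in F | s e \notin X] | t e \in Y]| = k false true.
  by apply: eq_card => e; rewrite !inE eqb_id eqbF_neg andbA.
have E00 : #|[set e in [set e in F | s e \notin X] | t e \notin Y]|
    = k false false.
  by apply: eq_card => e; rewrite !inE !eqbF_neg andbA.
have F11 : #|[set e in [set e in F | t e \in Y] | s e \in X]| = k true true.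
  by apply: eq_card => e; rewrite !inE !eqb_id -andbA [X in _ && X]andbC.
have F01 : #|[set e in [set e in F | t e \in Y] | s e \notin X]| = k false true.
  by apply: eq_card => e; rewrite !inE eqb_id eqbF_neg -andbA [X in _ && X]andbC.
rewrite E11 E10 in eX; rewrite E01 E00 in eXc; rewrite F11 F01 in eY.
(* The pair of classes with the larger sum covers at least half of [F]. Its two members differ by at
   most [2 * D], by the row and column sums, so each has at least [#|F| / 4 - D] elements. *)
case: (leqP (k true false + k false true) (k true true + k false false)) => h.
- by exists true => /=; lia.
- by exists false => /=; lia.
Qed.

Lemma disjoint_dense_sets (H : multigraph) (D t : nat) :
  (forall v, #|[set e : edge H | v \in ends e]| <= D) ->
  10 * t + 10 * D <= #|edge H| ->
  exists A B : {set mvertex H}, [disjoint A & B] /\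
    t <= #|[set e | ends e \subset A]| /\ t <= #|[set e | ends e \subset B]|.
Proof.
move=> degD big.
have [lr lrE] : exists lr : edge H -> mvertex H * mvertex H,
    forall e, ends e = [set (lr e).1; (lr e).2].
  apply: (@fin_all_exists _ _ (fun e p => ends e = [set p.1; p.2])) => e.
  by have /eqP/cards2P[x [y [_ ->]]] := card_ends e; exists (x, y).
pose l e := (lr e).1; pose r e := (lr e).2.
have {}lrE e : ends e = [set l e; r e] by apply: lrE.
have fiberD (F : {set edge H}) (s : edge H -> mvertex H) :
    (forall e, s e \in ends e) -> forall v, #|[set e in F | s e == v]| <= D.
  move=> sE v; apply: leq_trans (degD v); apply: subset_leq_card.
  by apply/subsetP=> e; rewrite !inE => /andP[_ /eqP <-].
have lE e : l e \in ends e by rewrite lrE !inE eqxx.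
have rE e : r e \in ends e by rewrite lrE !inE eqxx orbT.
have [X /= bX] := balanced_split (fiberD setT l lE).
pose F := [set e | (l e \in X) != (r e \in X)].
(* Above this threshold [crossed_split] gives classes of size at least [t]. Below it, at least
   [5 * t + 4 * D] sources lie on each side of [X], so at least [t] edges remain there once those of
   [F] are discarded. *)
case: (leqP (4 * t + 4 * D) #|F|) => [bigF | smallF].
(* On [F], [s] is the end inside [X] and [u] the end outside. *)
- pose s e := if l e \in X then l e else r e.
  pose u e := if l e \in X then r e else l e.
  have sE e : s e \in ends e by rewrite /s; case: ifP.
  have uE e : u e \in ends e by rewrite /u; case: ifP.
  have [X1 [Y1 /= [b [k1 k2]]]] := crossed_split (fiberD F s sE) (fiberD F u uE).
  (* [X1] matters only inside [X] and [Y1] only outside, so negating both [c] and [d] complements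
     [S c d]. *)
  pose S (c d : bool) := [set v | if v \in X then v \in X1 == c else v \in Y1 == d].
  have leS c d : #|[set e in F | (s e \in X1 == c) && (u e \in Y1 == d)]|
      <= #|[set e | ends e \subset S c d]|.
    apply: subset_leq_card; apply/subsetP=> e; rewrite !inE.
    rewrite lrE subUset !sub1set !inE /s /u.
    by case: (l e \in X); case: (r e \in X) => //= /andP[-> ->].
  exists (S true b), (S false (~~ b)); split.
    rewrite -setI_eq0; apply/eqP/setP=> v; rewrite !inE.
    by case: ifP => _; [case: (v \in X1) | case: (v \in Y1); case: (b)].
  by have := leS true b; have := leS false (~~ b); lia.
- exists X, (~: X); split; first by rewrite -setI_eq0 setICr.
  have sub1 : #|[set e in [set: edge H] | l e \in X]|
      <= #|F| + #|[set e | ends e \subset X]|.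
    apply: leq_trans (leq_card_setU _ _); apply: subset_leq_card.
    apply/subsetP=> e; rewrite !inE lrE subUset !sub1set.
    by case: (l e \in X); case: (r e \in X).
  have sub2 : #|[set e in [set: edge H] | l e \notin X]|
      <= #|F| + #|[set e | ends e \subset ~: X]|.
    apply: leq_trans (leq_card_setU _ _); apply: subset_leq_card.
    apply/subsetP=> e; rewrite !inE lrE subUset !sub1set !inE.
    by case: (l e \in X); case: (r e \in X).
  have := card_filter_predC [set: edge H] (fun e => l e \in X).
  by rewrite cardsT in bX *; lia.
Qed.

Lemma halve_set (T : finType) (A : {set T}) :
  exists P Q : {set T}, [/\ P \subset A, Q \subset A, [disjoint P & Q] &
    #|A| <= 2 * #|P| + 2 /\ #|A| <= 2 * #|Q| + 2].
Proof.
have fiber1 v : #|[set e in A | id e == v]| <= 1.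
  rewrite -(cards1 v); apply: subset_leq_card.
  by apply/subsetP=> e; rewrite !inE => /andP[].
have [X /= bX] := balanced_split fiber1.
exists (A :&: X), (A :\: X); split; rewrite ?subsetIl ?subsetDl //.
  rewrite -setI_eq0; apply/eqP/setP=> v; rewrite !inE.
  by case: (v \in X); rewrite ?andbF.
have -> : A :&: X = [set e in A | e \in X] by apply/setP=> e; rewrite !inE.
have := card_filter_predC A (fun e => e \in X).
have -> : [set e in A | e \notin X] = A :\: X.
  by apply/setP=> e; rewrite !inE andbC.
lia.
Qed.

Lemma line_graph_homogeneous (H : multigraph) :
  2 <= #|edge H| ->
  exists P Q : {set line_graph_of H}, homogeneous_pair P Q /\
    #|edge H| <= 200 * #|P| /\ #|edge H| <= 200 * #|Q|.
Proof.
move=> gt1; case: (leqP #|edge H| 200) => [small | big].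
  have /card_gt1P[x [y [_ _ xy]]] := gt1.
  exists [set x], [set y]; rewrite !cards1; split=> //; split.
    by rewrite disjoints1 inE.
  by case axy: (line_adj x y); [left | right] => _ _ /set1P-> /set1P->;
    rewrite /= axy.
(* A degree above [D] gives a large clique; otherwise [10 * D] uses up at most half of the edges. *)
pose D := #|edge H| %/ 20.
have [/existsP[v degv] | /existsPn degD] :=
    boolP [exists v, D < #|[set e : edge H | v \in ends e]|].
  have [P [Q [/subsetP PA /subsetP QA PQ [cP cQ]]]] :=
    halve_set [set e : edge H | v \in ends e].
  have cPQ : #|edge H| <= 200 * #|P| /\ #|edge H| <= 200 * #|Q|.
    by rewrite /D in degv; lia.
  exists P, Q; split; last exact: cPQ.
  split=> //; left=> x y xP yQ /=; rewrite /line_adj; apply/andP; split.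
    by apply: contraTneq yQ => <-; rewrite (disjointFr PQ xP).
  by apply/existsP; exists v; have := PA _ xP; have := QA _ yQ;
    rewrite !inE => -> ->.
have {}degD v : #|[set e : edge H | v \in ends e]| <= D by rewrite leqNgt degD.
(* The successor makes 200 times this value exceed the number of edges; the extra 10 is affordable
   since there are more than 200 edges. *)
have bigD : 10 * (#|edge H| %/ 200).+1 + 10 * D <= #|edge H| by rewrite /D; lia.
have [A [B [AB [cA cB]]]] := disjoint_dense_sets degD bigD.
(* Edges induced by [A] and by [B] share no endpoint, hence are nonadjacent in the line graph. *)
have apart x y : ends x \subset A -> ends y \subset B -> [disjoint ends x & ends y].
  by move=> xA yB; apply: disjointWl xA (disjointWr yB AB).
have cAB : #|edge H| <= 200 * #|[set e | ends e \subset A]| /\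
    #|edge H| <= 200 * #|[set e | ends e \subset B]| by lia.
exists [set e | ends e \subset A], [set e | ends e \subset B].
split; last exact: cAB.
split.
  (* An edge induced by both sets would have an empty set of ends. *)
  rewrite -setI_eq0; apply/eqP/setP=> x; rewrite !inE.
  apply/negP=> /andP[xA xB]; have := apart x x xA xB.
  by rewrite -setI_eq0 setIid -cards_eq0 card_ends.
right=> x y; rewrite !inE => xA yB; rewrite /= /line_adj negb_and.
apply/orP; right; apply/existsPn=> v; apply/negP=> /andP[vx vy].
by have := disjointFr (apart x y xA yB) vx; rewrite vy.
Qed.

Theorem theorem1p6 (R : realType) : strong_Erdos_Hajnal R is_line_graph.
Proof.
exists (200%:R^-1)%R; split; first by rewrite invr_gt0 ltr0n.
move=> G [H [f [g fK gK] adjf]] gt1.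
have cG : #|G| = #|edge H| by apply: (bij_eq_card (Bijective fK gK)).
have injf : injective f := can_inj fK.
have onf (S : {set edge H}) : #|f @^-1: S| = #|S|.
  by rewrite on_card_preimset //; exists g => x _; [apply: fK | apply: gK].
rewrite cG in gt1 *.
have [P [Q [[PQ hom] [cP cQ]]]] := line_graph_homogeneous gt1.
exists (f @^-1: P), (f @^-1: Q); split.
  split.
    rewrite -setI_eq0 -preimsetI; move: PQ; rewrite -setI_eq0 => /eqP->.
    by rewrite preimset0.
  by case: hom => hom; [left | right] => x y; rewrite !inE -adjf; apply: hom.
by rewrite !onf !ler_pdivrMl ?ltr0n // -!natrM !ler_nat.
Qed.
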